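(* Let $\Phi=(\Phi_A)$ be a potential on $\mathbb{Z}^d$ satisfying $$|||\Phi||| := \sup_{x\in\mathbb{Z}^d}\sum_{A\ni x}|A|\sup_\eta|\Phi_A(\eta)|<+\infty .$$ For every $0<\lambda<1$ there exists $\beta_\lambda>0$ such that for every finite $\Lambda\subset\mathbb{Z}^d$, every boundary condition $\tau\in\{0,1\}^{\Lambda^c}$, every $0\leq N\leq|\Lambda|$ and every $0<\beta\leq\beta_\lambda$, the generator $$\mathcal{L}f(\eta)=\sum_{xz}\frac{1}{|\Lambda|}e^{-\frac12\beta\nabla_{xz}H^\tau(\eta)}\,\nabla_{xz}f(\eta)$$ (sum over all unordered pairs of distinct sites $x,z\in\Lambda$), on the state space $S_N$ with invariant measure $\nu_\Lambda^N$, satisfies $\mathrm{gap}(\mathcal{L})\geq\lambda$. (That is, $\beta_\lambda$ is independent of $\Lambda,\tau,N$.)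
   Context: A potential is a family $\Phi=(\Phi_A)$ indexed by the finite subsets $A$ of $\mathbb{Z}^d$ with $\Phi_A:\{0,1\}^A\to\mathbb{R}$; $\Phi$ need not be translation invariant nor of finite range. For $\omega\in\{0,1\}^{\mathbb{Z}^d}$, $\Phi_A(\omega)$ means $\Phi_A(\omega|_A)$. For finite $\Lambda\subset\mathbb{Z}^d$, $\eta\in\{0,1\}^\Lambda$ and $\tau\in\{0,1\}^{\Lambda^c}$, $\eta\tau\in\{0,1\}^{\mathbb{Z}^d}$ is the configuration equal to $\eta$ on $\Lambda$ and to $\tau$ on $\Lambda^c$, and $H^\tau(\eta)=\sum_{A:A\cap\Lambda\neq\emptyset}\Phi_A(\eta\tau)$. For $x\neq z$ in $\Lambda$, $\eta^{xz}$ is obtained from $\eta$ by exchanging the values $\eta_x$ and $\eta_z$, and $\nabla_{xz}f(\eta)=f(\eta^{xz})-f(\eta)$. $S_N:=\{\eta\in\{0,1\}^\Lambda:\sum_{x\in\Lambda}\eta_x=N\}$, and $\nu_\Lambda^N(\eta)=e^{-\beta H^\tau(\eta)}/Z_\Lambda^N$ for $\eta\in S_N$, with $Z_\Lambda^N$ the normalization. $\mathrm{gap}(\mathcal{L})\in[0,+\infty]$ is the largest $k\geq0$ such that $k\,(\nu[f^2]-\nu[f]^2)\leq-\nu[f\mathcal{L}f]$ for all $f:S_N\to\mathbb{R}$, where $\nu=\nu_\Lambda^N$ and $\nu[\cdot]$ denotes expectation ($+\infty$ if $S_N$ is a singleton). *)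

(* Defs.v *)
From HB Require Import structures.
From mathcomp Require Import all_boot all_order all_algebra all_fingroup.
From mathcomp Require Import finmap.
From mathcomp Require Import all_classical all_reals all_analysis.

Set Implicit Arguments.
Unset Strict Implicit.
Unset Printing Implicit Defensive.

Import Order.TTheory GRing.Theory Num.Theory.
Local Open Scope fset_scope.
Local Open Scope classical_set_scope.
Local Open Scope ring_scope.

Notation Zd d := 'rV[int]_d.

(* {0,1} is represented by bool, with true for 1 (an occupied site). *)
Notation config d := (Zd d -> bool).

Definition potential (R : realType) (d : nat) :=
  forall A : {fset Zd d}, {ffun A -> bool} -> R.

Definition pot_at (R : realType) (d : nat) (Phi : potential R d)
    (A : {fset Zd d}) (omega : config d) : R :=
  Phi A [ffun x : A => omega (val x)].

Definition pot_norm (R : realType) (d : nat) (Phi : potential R d) : \bar R :=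
  ereal_sup (range (fun x : Zd d =>
    \esum_(A in [set A : {fset Zd d} | x \in A])
      ((#|` A|%:R)%:E *
       ereal_sup (range (fun omega : config d => `|pot_at Phi A omega|%:E)))%E)).


Notation boundary L := ({x | x \notin L} -> bool).

Definition glue (d : nat) (L : {fset Zd d}) (tau : boundary L)
    (eta : {ffun L -> bool}) : config d :=
  fun x => match boolP (x \in L) with
           | AltTrue xL => eta [` xL]
           | AltFalse xNL => tau (exist _ x xNL)
           end.

(* The sum over D of an absolutely summable real family; esum is only
   meaningful for nonnegative terms. *)
Definition usum (R : realType) (T : choiceType) (D : set T) (f : T -> R) : R :=
  fine (\esum_(i in D) (f^\+ i)%:E - \esum_(i in D) (f^\- i)%:E)%E.

Definition hamiltonian (R : realType) (d : nat) (Phi : potential R d)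
    (L : {fset Zd d}) (tau : boundary L) (eta : {ffun L -> bool}) : R :=
  usum [set A : {fset Zd d} | (A `&` L)%fset != fset0]
       (fun A => pot_at Phi A (glue tau eta)).

(* S_N; the booleans are coerced to nat in the sum. *)
Definition SN (d : nat) (L : {fset Zd d}) (N : nat) : finType :=
  {eta : {ffun L -> bool} | (\sum_(x : L) eta x)%N == N}.

Lemma exchange_subproof (d : nat) (L : {fset Zd d}) (N : nat) (x z : L)
    (eta : SN L N) :
  (\sum_(y : L) [ffun y => val eta (tperm x z y)] y)%N == N.
Proof.
case: eta => eta /= /eqP <-; rewrite [X in _ == X](reindex_inj (@perm_inj _ (tperm x z))) /=.
by apply/eqP/eq_bigr => y _; rewrite ffunE.
Qed.

Definition exchange (d : nat) (L : {fset Zd d}) (N : nat) (x z : L)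
    (eta : SN L N) : SN L N :=
  exist _ [ffun y => val eta (tperm x z y)] (exchange_subproof x z eta).

Definition nabla (R : realType) (d : nat) (L : {fset Zd d}) (N : nat)
    (x z : L) (f : SN L N -> R) (eta : SN L N) : R :=
  f (exchange x z eta) - f eta.

Definition HN (R : realType) (d : nat) (Phi : potential R d)
    (L : {fset Zd d}) (tau : boundary L) (N : nat) (eta : SN L N) : R :=
  hamiltonian Phi tau (val eta).

Definition nuN (R : realType) (d : nat) (Phi : potential R d) (beta : R)
    (L : {fset Zd d}) (tau : boundary L) (N : nat) (eta : SN L N) : R :=
  expR (- (beta * HN Phi tau eta)) /
  \sum_(zeta : SN L N) expR (- (beta * HN Phi tau zeta)).

(* Each unordered pair of distinct sites is listed once, as the pair (x, z)
   with x before z in the enumeration of L. *)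
Definition generator (R : realType) (d : nat) (Phi : potential R d) (beta : R)
    (L : {fset Zd d}) (tau : boundary L) (N : nat)
    (f : SN L N -> R) (eta : SN L N) : R :=
  \sum_(x : L) \sum_(z : L | (enum_rank x < enum_rank z)%N)
    #|` L|%:R^-1 * expR (- (2^-1 * beta * nabla x z (HN Phi tau (N:=N)) eta)) *
    nabla x z f eta.

Definition expect (R : realType) (S : finType) (nu f : S -> R) : R :=
  \sum_(s : S) nu s * f s.

Definition gap (R : realType) (S : finType) (nu : S -> R)
    (G : (S -> R) -> S -> R) : \bar R :=
  ereal_sup [set k%:E | k in [set k : R | 0 <= k /\
    forall f : S -> R,
      k * (expect nu (fun s => f s ^+ 2) - expect nu f ^+ 2) <=
      - expect nu (fun s => f s * G f s)]].

(* Main.v *)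
Require Import Defs.
From HB Require Import structures.
From mathcomp Require Import all_boot all_order all_algebra all_fingroup.
From mathcomp Require Import finmap.
From mathcomp Require Import all_classical all_reals all_analysis.
From mathcomp Require Import ring lra.

Set Implicit Arguments.
Unset Strict Implicit.
Unset Printing Implicit Defensive.

Import Order.TTheory GRing.Theory Num.Theory.
Local Open Scope fset_scope.
Local Open Scope ring_scope.

(* Write u = exp (- beta H / 2).  The rates satisfy nu(s) c(s,g) c(s,d) =
   u(gs) u(ds) / |L|^2 up to normalization, so nu[(Lf)^2] is the sum over pairs
   of exchanges g, d of u(gs) u(ds) (f(gs) - f(s)) (f(ds) - f(s)), and it
   suffices to bound it below by lambda times the Dirichlet form.  If g and d
   act on disjoint pairs of sites, they commute, and up to replacing
   u(gs) u(ds) by its mean over the square s, gs, ds, gds the contribution is a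
   sum of squares of second differences; the error is controlled by
   beta times the second differences of H, which are summable because of
   |||Phi|||.  Pairs sharing one site are computed by polarization on three
   sites, and together with the diagonal they give the full Dirichlet form up
   to a factor 1 - O(beta). *)

(** * The spectral gap from a Bochner inequality *)

Lemma expect_lin (R : realType) (S : finType) (nu f g : S -> R) (a : R) :
  expect nu (fun s => a * f s + g s) = a * expect nu f + expect nu g.
Proof.
rewrite /expect mulr_sumr -big_split; apply: eq_bigr => s _ /=.
by rewrite mulrDr mulrCA.
Qed.

(** Functions on the finite type [S] form a finite-dimensional space; read through [enum_rank], the
    operator is a square matrix with trivial kernel, hence invertible. *)
Lemma injective_surjective (R : realType) (S : finType) (A : (S -> R) -> S -> R) :
  (forall a f g, A (fun s => a * f s + g s) =1 (fun s => a * A f s + A g s)) ->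
  (forall f, A f =1 (fun=> 0) -> f =1 (fun=> 0)) ->
  forall f, exists g, A g =1 f.
Proof.
move=> Alin Ainj f.
pose vec (v : 'rV[R]_#|S|) s := v ord0 (enum_rank s).
pose F (v : 'rV[R]_#|S|) : 'rV[R]_#|S| := \row_j A (vec v) (enum_val j).
have FE v s : F v ord0 (enum_rank s) = A (vec v) s by rewrite mxE enum_rankK.
have Flin : linear F.
  move=> a v w; apply/rowP => j; rewrite !mxE -Alin.
  by congr A; apply/funext => s; rewrite /vec !mxE.
pose Fl : {linear 'rV[R]_#|S| -> 'rV[R]_#|S|} :=
  HB.pack F (GRing.isLinear.Build _ _ _ _ F Flin).
have Funit : lin1_mx Fl \in unitmx.
  rewrite -row_free_unit -kermx_eq0; apply/rowV0P => v /sub_kermxP.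
  rewrite mul_rV_lin1 => /= Fv0; apply/rowP => j; rewrite mxE.
  have /(_ (enum_val j)) : vec v =1 (fun=> 0).
    by apply: Ainj => s; rewrite -FE Fv0 mxE.
  by rewrite /vec enum_valK.
exists (vec ((\row_j f (enum_val j)) *m invmx (lin1_mx Fl))) => s.
rewrite -FE -[F _]/(Fl _) -mul_rV_lin1 -mulmxA mulVmx // mulmx1 mxE.
by rewrite enum_rankK.
Qed.

(* Solving f - nu(f) = - G g gives Var f = nu[(G g)^2] = - nu[f G g]; the
   inequality is then positivity of the Dirichlet form at f - k g. *)
Lemma poincare_of_bochner (R : realType) (S : finType) (nu : S -> R)
    (G : (S -> R) -> S -> R) (k : R) :
  0 <= k -> (\sum_s nu s = 1) ->
  (forall a f g, G (fun s => a * f s + g s) =1 (fun s => a * G f s + G g s)) ->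
  (forall c, G (fun=> c) =1 (fun=> 0)) ->
  (forall f g, expect nu (fun s => f s * G g s) =
               expect nu (fun s => g s * G f s)) ->
  (forall f, expect nu (fun s => f s * G f s) <= 0) ->
  (forall f, expect nu (fun s => f s * G f s) = 0 -> forall s t, f s = f t) ->
  (forall f, k * - expect nu (fun s => f s * G f s) <=
             expect nu (fun s => G f s ^+ 2)) ->
  forall f, k * (expect nu (fun s => f s ^+ 2) - expect nu f ^+ 2) <=
            - expect nu (fun s => f s * G f s).
Proof.
move=> k0 nu1 Glin Gc Gsym Gneg Gker Gboch f.
have Ec c : expect nu (fun=> c) = c by rewrite /expect -mulr_suml nu1 mul1r.
have EG g : expect nu (G g) = 0.
  transitivity (expect nu (fun s => 1 * G g s)).
    by congr expect; apply/funext => s; rewrite mul1r.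
  rewrite Gsym -[RHS](Ec 0); congr expect; apply/funext => s.
  by rewrite Gc mulr0.
(* [G] kills constants, so the mean of [g] is added to [- G g]. This makes the operator injective:
   taking expectations of [expect nu h - G h = 0] gives mean zero, then [G h = 0], so [h] is
   constant and equals its mean. *)
have [g gE] : exists g, (fun s => expect nu g - G g s) =1 f.
  apply: (injective_surjective
    (A := fun g s => expect nu g - G g s)) => [a h l s|h hE].
    by rewrite expect_lin Glin; ring.
  have Eh : expect nu h = 0.
    have : expect nu (fun s => expect nu h - G h s) = 0.
      by rewrite -[RHS](Ec 0); congr expect; apply/funext.
    have -> : (fun s => expect nu h - G h s) =
              (fun s => -1 * G h s + expect nu h).
      by apply/funext => s; ring.
    by rewrite expect_lin EG Ec mulr0 add0r.
  have Gh0 s : G h s = 0 by have := hE s; rewrite Eh; lra.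
  have hc : forall s t, h s = h t.
    apply: Gker; rewrite -[RHS](Ec 0); congr expect; apply/funext => s.
    by rewrite Gh0 mulr0.
  move=> s; rewrite -Eh -[LHS]Ec; congr expect; apply/funext => t; exact: hc.
set V := expect nu (fun s => G g s ^+ 2).
set e := expect nu g in gE.
have VE : expect nu (fun s => f s ^+ 2) - expect nu f ^+ 2 = V.
  have -> : expect nu f = e.
    transitivity (expect nu (fun s => -1 * G g s + e)).
      by congr expect; apply/funext => s; rewrite -gE; ring.
    by rewrite expect_lin EG Ec; ring.
  have -> : (fun s => f s ^+ 2) =
      (fun s => -1 * (2 * e * G g s + - e ^+ 2) + G g s ^+ 2).
    by apply/funext => s; rewrite -gE; ring.
  by rewrite !expect_lin EG Ec -/V; ring.
have Efg : expect nu (fun s => f s * G g s) = - V.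
  have -> : (fun s => f s * G g s) =
      (fun s => e * G g s + (-1 * G g s ^+ 2 + 0)).
    by apply/funext => s; rewrite -gE; ring.
  by rewrite !expect_lin EG Ec -/V; ring.
(* With [a = nu[g G g]] and [b = nu[f G f]], nonpositivity at [f - k g] reads
   [k^2 a + 2 k V + b <= 0], and the Bochner hypothesis times [k] reads [- k^2 a <= k V]; together
   they give [k V <= - b]. *)
have := Gneg (fun s => - k * g s + f s).
have -> : (fun s => (- k * g s + f s) * G (fun s => - k * g s + f s) s) =
   (fun s => k ^+ 2 * (g s * G g s) + (- k * (g s * G f s) +
      (- k * (f s * G g s) + f s * G f s))).
  by apply/funext => s; rewrite Glin; ring.
rewrite !expect_lin Gsym Efg VE.
have := ler_wpM2l k0 (Gboch g); rewrite -/V.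
set a := expect nu (fun s => g s * G g s); set b := expect _ _.
move=> h1 h2; nra.
Qed.

(** * Exchanges *)

Lemma exchangeE (d : nat) (L : {fset Zd d}) (N : nat) (x z y : L) (eta : SN L N) :
  val (exchange x z eta) y = val eta (tperm x z y).
Proof. by rewrite /= ffunE. Qed.

Lemma exchangeK (d : nat) (L : {fset Zd d}) (N : nat) (x z : L) :
  involutive (@exchange d L N x z).
Proof. by move=> s; apply/val_inj/ffunP => y; rewrite !exchangeE tpermK. Qed.

Lemma exchangeC (d : nat) (L : {fset Zd d}) (N : nat) (x z : L) (s : SN L N) :
  exchange x z s = exchange z x s.
Proof. by apply/val_inj/ffunP => y; rewrite !exchangeE tpermC. Qed.

Lemma exchange_eq (d : nat) (L : {fset Zd d}) (N : nat) (x z : L) (s : SN L N) :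
  val s x = val s z -> exchange x z s = s.
Proof.
by move=> e; apply/val_inj/ffunP => y; rewrite exchangeE; case: tpermP => // ->.
Qed.

(** Neither [x != y] nor [a != b] is imposed: exchanging a site with itself is the identity, so
    degenerate pairs have zero gradient. *)
Definition disjoint_pairs (T : eqType) (x y a b : T) : bool :=
  [&& a != x, a != y, b != x & b != y].

Definition distinct3 (T : eqType) (x y z : T) : bool :=
  [&& x != y, x != z & y != z].

Lemma tperm_disjoint (T : finType) (x y a b w : T) : disjoint_pairs x y a b ->
  tperm a b (tperm x y w) = tperm x y (tperm a b w).
Proof.
case/and4P => ax ay bx byy.
have xE : tperm a b x = x by rewrite tpermD.
have yE : tperm a b y = y by rewrite tpermD.
have [->|wx] := eqVneq w x; first by rewrite xE tpermL yE.
have [->|wy] := eqVneq w y; first by rewrite yE tpermR xE.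
have -> : tperm x y w = w by rewrite tpermD // eq_sym.
by case: (tpermP a b w) => [_|_|_ _]; rewrite tpermD // eq_sym.
Qed.

Lemma exchange_comm (d : nat) (L : {fset Zd d}) (N : nat) (x y a b : L)
    (s : SN L N) : disjoint_pairs x y a b ->
  exchange x y (exchange a b s) = exchange a b (exchange x y s).
Proof.
move=> dis; apply/val_inj/ffunP => w; rewrite !exchangeE.
by congr (val s _); apply: tperm_disjoint.
Qed.

(** The 3-cycle on the left and the transposition on the right differ only by interchanging the
    values [y] and [z], which [F] does not distinguish. *)
Lemma tperm_cycle (T : finType) (U : Type) (F : T -> U) (x y z w : T) :
  distinct3 x y z -> F y = F z ->
  F (tperm x y (tperm y z w)) = F (tperm x z w).
Proof.
case/and3P => xy xz yz e.
have [->|wx] := eqVneq w x.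
  have -> : tperm y z x = x by rewrite tpermD // eq_sym.
  by rewrite !tpermL.
have [->|wy] := eqVneq w y.
  have -> : tperm x z y = y by rewrite tpermD // eq_sym.
  by rewrite tpermL tpermD.
have [->|wz] := eqVneq w z; first by rewrite !tpermR.
have -> : tperm y z w = w by rewrite tpermD // eq_sym.
by rewrite !tpermD // eq_sym.
Qed.

Lemma exchange_cycle (d : nat) (L : {fset Zd d}) (N : nat) (x y z : L)
    (s : SN L N) : distinct3 x y z -> val s y = val s z ->
  exchange y z (exchange x y s) = exchange x z s.
Proof.
move=> dis e; apply/val_inj/ffunP => w; rewrite !exchangeE.
exact: (tperm_cycle (F := val s)).
Qed.

Lemma sum_involution (R : realType) (S : finType) (g : S -> S) (F : S -> R) :
  involutive g -> \sum_s F (g s) = \sum_s F s.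
Proof. by move=> gK; rewrite [RHS](reindex_inj (can_inj gK)). Qed.

(* The average of u(gs) u(ds) and u(s) u(gds) is constant on the orbits of the
   group generated by g and d, so replacing u(gs) u(ds) by it leaves a sum of
   squares of second differences. *)
Lemma commuting_moves_ge (R : realType) (S : finType) (g d : S -> S)
    (u f : S -> R) :
  involutive g -> involutive d -> (forall s, g (d s) = d (g s)) ->
  (forall s, 0 <= u s) ->
  - (\sum_s `|u (g s) * u (d s) - u s * u (g (d s))| / 4 *
      ((f (g s) - f s) ^+ 2 + (f (d s) - f s) ^+ 2)) <=
  \sum_s (u (g s) * (f (g s) - f s)) * (u (d s) * (f (d s) - f s)).
Proof.
move=> gK dK gd u0.
pose W s := (u (g s) * u (d s) + u s * u (g (d s))) / 2.
pose Q s := W s * (f (g s) - f s) * (f (d s) - f s).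
have Q0 : 0 <= \sum_s Q s.
  suff : 0 <= 4 * \sum_s Q s by rewrite pmulr_rge0.
  (* Each of the four points of the orbit of [s] runs over [S] once, so all four sums are equal; the
     sum of [Q] over an orbit is [W s] times the square of the second difference of [f]. *)
  have -> : 4 * \sum_s Q s = \sum_s (Q s + Q (g s) + (Q (d s) + Q (g (d s)))).
    rewrite !big_split /= (sum_involution _ gK) (sum_involution _ dK).
    rewrite (sum_involution (fun s => Q (g s)) dK) (sum_involution _ gK).
    by ring.
  apply: sumr_ge0 => s _.
  have W0 : 0 <= W s by rewrite divr_ge0 // addr_ge0 // mulr_ge0.
  have e : d (g s) = g (d s) by rewrite gd.
  have e' : d (g (d s)) = g s by rewrite -gd dK.
  rewrite /Q /W !gK !e !dK !e' !gK -/(W s).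
  rewrite [leRHS](_ : _ = W s * (f (g s) + f (d s) - f s - f (g (d s))) ^+ 2).
    by rewrite mulr_ge0 // sqr_ge0.
  by rewrite /W; field.
(* Replacing [A] by the mean [(A + B) / 2] costs [(A - B) / 2 * p * q], and
   [|p q| <= (p^2 + q^2) / 2]. *)
rewrite -subr_ge0 opprK -big_split /=; apply: le_trans Q0 _.
apply: ler_sum => s _; rewrite /Q /W.
set A := u (g s) * u (d s); set B := u s * u (g (d s)).
set p := f (g s) - f s; set q := f (d s) - f s.
have -> : u (g s) * p * (u (d s) * q) = A * p * q by rewrite /A; ring.
have := ler_norm (B - A); rewrite distrC => h1.
have := ler_norm (A - B) => h2.
have := sqr_ge0 (p - q); have := sqr_ge0 (p + q).
move: h1 h2; set V := `|A - B|; move=> h1 h2 h3 h4.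
nra.
Qed.

(** * Pairs of exchanges sharing one site *)

Lemma distinct3_rot (T : eqType) (x y z : T) : distinct3 x y z = distinct3 y z x.
Proof.
rewrite /distinct3 (eq_sym y x) (eq_sym z x).
by case: (x == y); case: (x == z); case: (y == z).
Qed.

Lemma distinct3_swap (T : eqType) (x y z : T) : distinct3 x y z = distinct3 y x z.
Proof.
rewrite /distinct3 (eq_sym y x).
by case: (x == y); case: (x == z); case: (y == z).
Qed.

Definition sum3 (R : realType) (T : finType) (F : T -> T -> T -> R) : R :=
  \sum_x \sum_y \sum_(z | distinct3 x y z) F x y z.

(** With the constraint written as a factor, the three sums can be permuted freely. *)
Lemma sum3E (R : realType) (T : finType) (F : T -> T -> T -> R) :
  sum3 F = \sum_x \sum_y \sum_z (distinct3 x y z)%:R * F x y z.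
Proof.
apply: eq_bigr => x _; apply: eq_bigr => y _; rewrite big_mkcond.
by apply: eq_bigr => z _; case: ifP; rewrite ?mul1r ?mul0r.
Qed.

Lemma sum3_swap (R : realType) (T : finType) (F : T -> T -> T -> R) :
  sum3 (fun x y z => F y x z) = sum3 F.
Proof.
rewrite !sum3E exchange_big /=; apply: eq_bigr => x _; apply: eq_bigr => y _.
by apply: eq_bigr => z _; rewrite distinct3_swap.
Qed.

Lemma sum3_rot (R : realType) (T : finType) (F : T -> T -> T -> R) :
  sum3 (fun x y z => F y z x) = sum3 F.
Proof.
rewrite !sum3E exchange_big /=; transitivity
  (\sum_x \sum_y \sum_z (distinct3 y x z)%:R * F x z y) => //.
apply: eq_bigr => x _; rewrite exchange_big /=; apply: eq_bigr => y _.
by apply: eq_bigr => z _; rewrite distinct3_rot.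
Qed.

Lemma sum3_swap23 (R : realType) (T : finType) (F : T -> T -> T -> R) :
  sum3 (fun x y z => F x z y) = sum3 F.
Proof. by rewrite -(sum3_rot F) -(sum3_swap (fun x y z => F y z x)). Qed.

Lemma ler_sum3 (R : realType) (T : finType) (F G : T -> T -> T -> R) :
  (forall x y z, distinct3 x y z -> F x y z <= G x y z) -> sum3 F <= sum3 G.
Proof.
move=> FG; apply: ler_sum => x _; apply: ler_sum => y _.
by apply: ler_sum => z; exact: FG.
Qed.

Lemma sum3D (R : realType) (T : finType) (F G : T -> T -> T -> R) (a b : R) :
  sum3 (fun x y z => a * F x y z + b * G x y z) = a * sum3 F + b * sum3 G.
Proof.
rewrite /sum3 !mulr_sumr -big_split; apply: eq_bigr => x _ /=.
rewrite !mulr_sumr -big_split; apply: eq_bigr => y _ /=.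
by rewrite !mulr_sumr -big_split.
Qed.

(** For [x != y] the third site has [#|T| - 2] choices; for [x = y] both sides vanish. *)
Lemma sum3_const (R : realType) (T : finType) (b : T -> T -> R) :
  (forall x, b x x = 0) ->
  sum3 (fun x y _ => b x y) = (#|T|%:R - 2) * \sum_x \sum_y b x y.
Proof.
move=> b0; rewrite mulr_sumr; apply: eq_bigr => x _.
rewrite mulr_sumr; apply: eq_bigr => y _; rewrite sumr_const.
have [<-|xy] := eqVneq x y; first by rewrite b0 mul0rn mulr0.
rewrite -[LHS]mulr_natl; congr (_ * _).
rewrite (eq_card (B := predC (pred2 x y))) => [|z].
  by rewrite -(cardC (pred2 x y)) card2 xy natrD addrAC subrr add0r.
transitivity (distinct3 x y z); first by rewrite unfold_in /distinct3 xy.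
by rewrite /distinct3 xy !inE negb_or ![_ == z]eq_sym.
Qed.

(** Up to normalization, the part of [nu[(L f)^2]] coming from the two exchanges [xy] and [ab], with
    [u] in the role of [exp (- beta H / 2)]. *)
Definition dsum (R : realType) (d : nat) (L : {fset Zd d}) (N : nat)
    (u f : SN L N -> R) (x y a b : L) : R :=
  \sum_s (u (exchange x y s) * nabla x y f s) *
         (u (exchange a b s) * nabla a b f s).

(** Up to normalization, the part of the Dirichlet form carried by the exchange [xy]. *)
Definition bond (R : realType) (d : nat) (L : {fset Zd d}) (N : nat)
    (u f : SN L N -> R) (x y : L) : R :=
  \sum_s u s * u (exchange x y s) * nabla x y f s ^+ 2.

Definition odd_one (d : nat) (L : {fset Zd d}) (N : nat) (x y z : L)
    (s : SN L N) : bool := (val s x != val s y) && (val s y == val s z).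

Definition odd_bond (R : realType) (d : nat) (L : {fset Zd d}) (N : nat)
    (w f : SN L N -> R) (x y z : L) : R :=
  \sum_(s | odd_one x y z s) w s * nabla x y f s ^+ 2.

Lemma nabla_eq0 (R : realType) (d : nat) (L : {fset Zd d}) (N : nat)
    (f : SN L N -> R) (x y : L) (s : SN L N) :
  val s x = val s y -> nabla x y f s = 0.
Proof. by move=> e; rewrite /nabla exchange_eq // subrr. Qed.

(** The gradient vanishes unless [x] and [y] carry different values, and then [z] agrees with
    exactly one of them. *)
Lemma odd_bondD (R : realType) (d : nat) (L : {fset Zd d}) (N : nat)
    (w f : SN L N -> R) (x y z : L) :
  odd_bond w f x y z + odd_bond w f y x z =
  \sum_s w s * nabla x y f s ^+ 2.
Proof.
rewrite /odd_bond big_mkcond [X in _ + X]big_mkcond -big_split.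
apply: eq_bigr => s _ /=; rewrite /odd_one.
have -> : nabla y x f s = nabla x y f s by rewrite /nabla exchangeC.
have [e|ne] := eqVneq (val s x) (val s y).
  by rewrite nabla_eq0 // expr0n /= mulr0 addr0.
case: (val s x) (val s y) (val s z) ne => [] [] [] //= _;
  by rewrite ?addr0 ?add0r.
Qed.

(* Polarization: the product of the two gradients is half of the sum of their
   squares minus the square of f(s^xy) - f(s^xz).  It only counts when x is the
   odd one out, and then s^xz is the exchange of y and z in s^xy. *)
Lemma dsum_shared (R : realType) (d : nat) (L : {fset Zd d}) (N : nat)
    (u f : SN L N -> R) (x y z : L) : distinct3 x y z ->
  dsum u f x y x z =
    2^-1 * odd_bond (fun s => u (exchange x y s) * u (exchange x z s)) f x y z +
    2^-1 * odd_bond (fun s => u (exchange x y s) * u (exchange x z s)) f x z y -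
    2^-1 * odd_bond (fun s => u s * u (exchange y z s)) f y z x.
Proof.
move=> dis; have /and3P[xy xz yz] := dis.
have -> : odd_bond (fun s => u s * u (exchange y z s)) f y z x =
    \sum_(s | odd_one x y z s) u (exchange x y s) * u (exchange x z s) *
      (f (exchange x z s) - f (exchange x y s)) ^+ 2.
  (* Substituting [s^xy] for [s]: [y] is the odd site of [s^xy] exactly when [x] is the odd site of
     [s]. *)
  rewrite /odd_bond (reindex_inj (can_inj (exchangeK x y))) /=.
  apply: eq_big => s.
    rewrite /odd_one !exchangeE tpermL tpermR tpermD //.
    by case: (val s x) (val s y) (val s z) => [] [] [].
  rewrite /odd_one !exchangeE tpermL tpermR tpermD // => /andP[_ /eqP e].
  by rewrite /nabla exchange_cycle.
have -> : odd_bond (fun s => u (exchange x y s) * u (exchange x z s)) f x z y =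
  \sum_(s | odd_one x y z s) u (exchange x y s) * u (exchange x z s) *
     nabla x z f s ^+ 2.
  apply: eq_bigl => s; rewrite /odd_one.
  by case: (val s x) (val s y) (val s z) => [] [] [].
rewrite /odd_bond !mulr_sumr -big_split -sumrB /= [RHS]big_mkcond.
apply: eq_bigr => s _; case: ifPn => [_|].
  by rewrite /nabla; field.
rewrite /odd_one => h.
(* If [x] is not the odd site, it agrees with [y] or [z], so one factor of the product is zero. *)
have [e|e] : val s x = val s y \/ val s x = val s z.
- by case: (val s x) (val s y) (val s z) h => [] [] []; auto.
- by rewrite [nabla x y f s]nabla_eq0 // !mulr0 mul0r.
- by rewrite [nabla x z f s]nabla_eq0 // !mulr0.
Qed.

(** In [dsum_shared] the two positive terms are at least [r / 2] times terms [P], the negative one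
    is [P / 2]. All three have the same total over triples, hence the factor [r - 1/2]; symmetrizing
    [P] in its first two sites gives [bond], so this total is [(n - 2) / 2] times the sum of
    bonds. *)
Lemma sum3_shared_ge (R : realType) (d : nat) (L : {fset Zd d}) (N : nat)
    (u f : SN L N -> R) (r : R) :
  (forall s, 0 < u s) -> (forall x y s, r * u s <= u (exchange x y s)) ->
  (r - 2^-1) / 2 * (#|{: L}|%:R - 2) * (\sum_x \sum_y bond u f x y) <=
  sum3 (fun x y z => dsum u f x y x z).
Proof.
move=> u0 ur.
pose w x y (s : SN L N) := u s * u (exchange x y s).
pose P x y z := odd_bond (w x y) f x y z.
have PE : sum3 P = 2^-1 * (#|{: L}|%:R - 2) * (\sum_x \sum_y bond u f x y).
  have : sum3 (fun x y z => 1 * P x y z + 1 * P y x z) =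
         sum3 (fun x y _ => bond u f x y).
    congr sum3; apply/funext => x; apply/funext => y; apply/funext => z.
    rewrite !mul1r /P [RHS]/bond -(odd_bondD (w x y) f x y z); congr (_ + odd_bond _ _ _ _ _).
    by apply/funext => s; rewrite /w exchangeC.
  rewrite sum3D (sum3_swap P) sum3_const => [e|x].
    by rewrite -mulrA -e; field.
  by apply: big1 => s _; rewrite nabla_eq0 // expr0n mulr0.
have le : sum3 (fun x y z => 2^-1 * r * (P x y z) + 1 *
      (2^-1 * r * P x z y + - 2^-1 * P y z x)) <= sum3 (fun x y z => dsum u f x y x z).
  apply: ler_sum3 => x y z dis; rewrite dsum_shared // mul1r addrA mulNr.
  have aux y' z' : r * P x y' z' <=
      odd_bond (fun s => u (exchange x y' s) * u (exchange x z' s)) f x y' z'.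
    rewrite /P /odd_bond mulr_sumr; apply: ler_sum => s _.
    rewrite mulrA ler_wpM2r ?sqr_ge0 // /w mulrA mulrC ler_wpM2l //.
    exact: ltW.
  rewrite lerB // lerD // -mulrA ler_wpM2l // ?invr_ge0 //.
  have -> : (fun s => u (exchange x y s) * u (exchange x z s)) =
            (fun s => u (exchange x z s) * u (exchange x y s)).
    by apply/funext => s; rewrite mulrC.
  exact: aux.
apply: le_trans le; rewrite sum3D sum3D (sum3_rot P) (sum3_swap23 P) PE.
by rewrite le_eqVlt; apply/orP; left; apply/eqP; field.
Qed.

(** * The Bochner inequality for exchange dynamics *)

Lemma sum_delta (R : realType) (T : finType) (x : T) (g : T -> R) :
  \sum_a (a == x)%:R * g a = g x.
Proof.
rewrite (bigD1 x) //= eqxx mul1r big1 ?addr0 // => a /negPf ->.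
by rewrite mul0r.
Qed.

(** The cases are: no common site, one common site (four positions), both sites common (two orders).
    The symmetries of [D] move the common site to first place. *)
Lemma quadruple_split (R : realType) (T : eqType) (D : T -> T -> T -> T -> R)
    (x y a b : T) :
  (forall x y a b, D y x a b = D x y a b) ->
  (forall x y a b, D x y b a = D x y a b) ->
  (forall x a b, D x x a b = 0) -> (forall x y a, D x y a a = 0) ->
  D x y a b = (disjoint_pairs x y a b)%:R * D x y a b +
    ((a == x)%:R * ((distinct3 x y b)%:R * D x y x b) +
     (b == x)%:R * ((distinct3 x y a)%:R * D x y x a)) +
    ((a == y)%:R * ((distinct3 y x b)%:R * D y x y b) +
     (b == y)%:R * ((distinct3 y x a)%:R * D y x y a)) +
    ((a == x)%:R * ((b == y)%:R * D x y x y) +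
     (a == y)%:R * ((b == x)%:R * D x y x y)).
Proof.
move=> DC DC' D0 D0'.
have [<-|xy] := eqVneq x y; first by rewrite !D0; ring.
have [<-|ab] := eqVneq a b.
  rewrite D0' /distinct3 (eq_sym y x).
  have [->|ax] := eqVneq a x.
    by rewrite (negPf xy) ?eqxx ?andbF /=; ring.
  have [->|ay] := eqVneq a y; first by rewrite ?eqxx ?andbF /=; ring.
  by rewrite /=; ring.
rewrite /disjoint_pairs /distinct3 (eq_sym y x) xy.
have [ax|ax] := eqVneq a x.
  move: ab; rewrite ax (negPf xy) eq_sym => bx; rewrite (negPf bx).
  have [->|yb] := eqVneq b y; first by rewrite ?eqxx ?andbF /=; ring.
  by rewrite ?(eq_sym x b) ?(eq_sym y b) ?bx ?yb /=; ring.
have [ay|ay] := eqVneq a y.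
  move: ab; rewrite ay eq_sym => yb; rewrite (negPf yb).
  have [->|bx] := eqVneq b x; first by rewrite /= (DC' x y x y); ring.
  by rewrite ?(eq_sym y b) ?(eq_sym x b) ?yb ?bx /= (DC x y y b); ring.
have [->|bx] := eqVneq b x.
  by rewrite ?(negPf xy) ?(eq_sym x a) ?(eq_sym y a) ?ax ?ay /= (DC' x y a x); ring.
have [->|byy] := eqVneq b y.
  by rewrite ?(eq_sym x a) ?(eq_sym y a) ?ax ?ay /= (DC x y y a) (DC' x y a y); ring.
by rewrite /=; ring.
Qed.

Lemma sum_quadruples (R : realType) (T : finType) (D : T -> T -> T -> T -> R) :
  (forall x y a b, D y x a b = D x y a b) ->
  (forall x y a b, D x y b a = D x y a b) ->
  (forall x a b, D x x a b = 0) -> (forall x y a, D x y a a = 0) ->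
  \sum_x \sum_y \sum_a \sum_b D x y a b =
  \sum_x \sum_y \sum_a \sum_(b | disjoint_pairs x y a b) D x y a b +
  4 * sum3 (fun x y z => D x y x z) + 2 * \sum_x \sum_y D x y x y.
Proof.
move=> DC DC' D0 D0'.
have inner x y : \sum_a \sum_b D x y a b =
    \sum_a \sum_(b | disjoint_pairs x y a b) D x y a b +
    2 * \sum_(z | distinct3 x y z) D x y x z +
    (2 * \sum_(z | distinct3 y x z) D y x y z + 2 * D x y x y).
  under eq_bigr do under eq_bigr do rewrite (quadruple_split _ _ _ _ DC DC' D0 D0').
  pose g z := (distinct3 x y z)%:R * D x y x z.
  pose h z := (distinct3 y x z)%:R * D y x y z.
  have gE : \sum_(z | distinct3 x y z) D x y x z = \sum_z g z.
    rewrite big_mkcond; apply: eq_bigr => z _.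
    by rewrite /g; case: ifP; rewrite ?mul1r ?mul0r.
  have hE : \sum_(z | distinct3 y x z) D y x y z = \sum_z h z.
    rewrite big_mkcond; apply: eq_bigr => z _.
    by rewrite /h; case: ifP; rewrite ?mul1r ?mul0r.
  have dl v (k : T -> R) : \sum_a \sum_b (a == v)%:R * k b = \sum_z k z.
    under eq_bigr do rewrite -mulr_sumr.
    exact: (sum_delta v (fun=> \sum_z k z)).
  have dr v (k : T -> R) : \sum_a \sum_b (b == v)%:R * k a = \sum_z k z.
    by apply: eq_bigr => a _; rewrite (sum_delta v (fun=> k a)).
  rewrite gE hE; under eq_bigr do rewrite !big_split /=.
  rewrite !big_split /= !dl !dr !sum_delta -/g -/h.
  rewrite (_ : \sum_a \sum_b _ = \sum_a \sum_(b | disjoint_pairs x y a b) D x y a b).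
    by ring.
  apply: eq_bigr => a _; rewrite [RHS]big_mkcond; apply: eq_bigr => b _.
  by case: ifP; rewrite ?mul1r ?mul0r.
under eq_bigr do under eq_bigr do rewrite inner.
under eq_bigr do rewrite !big_split /= -!mulr_sumr.
rewrite !big_split /= -!mulr_sumr [X in _ + (2 * X + _)]exchange_big /=.
by rewrite -/(sum3 (fun x y z => D x y x z)); ring.
Qed.

Lemma dsumC (R : realType) (d : nat) (L : {fset Zd d}) (N : nat)
    (u f : SN L N -> R) (x y a b : L) :
  dsum u f x y b a = dsum u f x y a b.
Proof.
by rewrite /dsum; apply: eq_bigr => s _; rewrite /nabla (exchangeC b a).
Qed.

Lemma dsumCl (R : realType) (d : nat) (L : {fset Zd d}) (N : nat)
    (u f : SN L N -> R) (x y a b : L) :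
  dsum u f y x a b = dsum u f x y a b.
Proof.
by rewrite /dsum; apply: eq_bigr => s _; rewrite /nabla (exchangeC y x).
Qed.

(** Write [B] for the sum of bonds. Disjoint pairs give at least [- (c n / 2) B], pairs sharing one
    site [(2 r - 1) (n - 2) B], the diagonal [2 r B]. The total exceeds the claim by
    [2 (1 - r) B >= 0]. *)
Lemma bochner (R : realType) (d : nat) (L : {fset Zd d}) (N : nat)
    (u f : SN L N -> R) (r c : R) :
  (forall s, 0 < u s) -> r <= 1 ->
  (forall x y s, r * u s <= u (exchange x y s)) ->
  (forall x y s, \sum_a \sum_(b | disjoint_pairs x y a b)
     `|u (exchange x y s) * u (exchange a b s) -
       u s * u (exchange x y (exchange a b s))| <=
     c * #|{: L}|%:R * (u s * u (exchange x y s))) ->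
  (2 * r - 1 - c / 2) * #|{: L}|%:R * (\sum_x \sum_y bond u f x y) <=
  \sum_s (\sum_x \sum_y u (exchange x y s) * nabla x y f s) ^+ 2.
Proof.
move=> u0 r1 ur uc; set n := #|{: L}|%:R; set B := \sum_x \sum_y bond u f x y.
have nabla0 x s : nabla x x f s = 0 by exact: nabla_eq0.
have -> : \sum_s (\sum_x \sum_y u (exchange x y s) * nabla x y f s) ^+ 2 =
          \sum_x \sum_y \sum_a \sum_b dsum u f x y a b.
  under eq_bigr do rewrite expr2 mulr_suml.
  rewrite exchange_big /=; apply: eq_bigr => x _.
  under eq_bigr do rewrite mulr_suml.
  rewrite exchange_big /=; apply: eq_bigr => y _.
  under eq_bigr do rewrite mulr_sumr.
  rewrite exchange_big /=; apply: eq_bigr => a _.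
  under eq_bigr do rewrite mulr_sumr.
  by rewrite exchange_big.
rewrite sum_quadruples; first last.
- by move=> x y a; apply: big1 => s _; rewrite nabla0 !mulr0.
- by move=> x a b; apply: big1 => s _; rewrite nabla0 mulr0 mul0r.
- by move=> x y a b; exact: dsumC.
- by move=> x y a b; exact: dsumCl.
have B0 : 0 <= B.
  apply: sumr_ge0 => x _; apply: sumr_ge0 => y _; apply: sumr_ge0 => s _.
  by rewrite mulr_ge0 ?sqr_ge0 // mulr_ge0 // ltW.
have diag : r * B <= \sum_x \sum_y dsum u f x y x y.
  rewrite mulr_sumr; apply: ler_sum => x _.
  rewrite mulr_sumr; apply: ler_sum => y _.
  rewrite mulr_sumr; apply: ler_sum => s _.
  rewrite [leRHS](_ : _ = u (exchange x y s) * u (exchange x y s) *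
     nabla x y f s ^+ 2); last by ring.
  rewrite mulrA ler_wpM2r ?sqr_ge0 // mulrA ler_wpM2r //; exact: ltW.
have shared := sum3_shared_ge f u0 ur; rewrite -/n -/B in shared.
have disj : - (c * n / 2 * B) <=
    \sum_x \sum_y \sum_a \sum_(b | disjoint_pairs x y a b) dsum u f x y a b.
  pose V x y a b s : R := `|u (exchange x y s) * u (exchange a b s) -
       u s * u (exchange x y (exchange a b s))|.
  pose C x y a b := \sum_s V x y a b s / 4 * nabla x y f s ^+ 2.
  have le1 : - (\sum_x \sum_y \sum_a \sum_(b | disjoint_pairs x y a b)
        (C x y a b + C a b x y)) <=
      \sum_x \sum_y \sum_a \sum_(b | disjoint_pairs x y a b) dsum u f x y a b.
    rewrite -sumrN; apply: ler_sum => x _; rewrite -sumrN; apply: ler_sum => y _.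
    rewrite -sumrN; apply: ler_sum => a _; rewrite -sumrN; apply: ler_sum => b dis.
    rewrite /dsum /C -big_split /=.
    apply: le_trans (commuting_moves_ge f (exchangeK x y) (exchangeK a b) _ _);
      last 2 first.
    - by move=> s; exact: exchange_comm.
    - by move=> s; exact: ltW.
    rewrite lerN2 le_eqVlt; apply/orP; left; apply/eqP; apply: eq_bigr => s _.
    rewrite /V -(exchange_comm _ dis) (mulrC (u (exchange a b s))).
    by rewrite -mulrDr.
  apply: le_trans le1; rewrite lerN2.
  (* Both error terms have the same total, by interchanging the roles of the two pairs. *)
  have -> : \sum_x \sum_y \sum_a \sum_(b | disjoint_pairs x y a b)
        (C x y a b + C a b x y) =
      2 * \sum_x \sum_y \sum_a \sum_(b | disjoint_pairs x y a b) C x y a b.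
    have Dsym x y a b : disjoint_pairs (T := L) x y a b = disjoint_pairs a b x y.
      rewrite /disjoint_pairs (eq_sym x a) (eq_sym x b) (eq_sym y a) (eq_sym y b).
      by case: (a == x); case: (a == y); case: (b == x); case: (b == y).
    under eq_bigr do under eq_bigr do under eq_bigr do rewrite big_split /=.
    under eq_bigr do under eq_bigr do rewrite big_split /=.
    under eq_bigr do rewrite big_split /=.
    rewrite big_split /= mulr_natl mulr2n; congr (_ + _).
    pose F x y a b := if disjoint_pairs x y a b then C x y a b else 0.
    transitivity (\sum_x \sum_y \sum_a \sum_b F a b x y).
      apply: eq_bigr => x _; apply: eq_bigr => y _; apply: eq_bigr => a _.
      rewrite big_mkcond; apply: eq_bigr => b _; by rewrite /F Dsym.
    rewrite pair_big /=; under eq_bigr do rewrite pair_big /=.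
    rewrite exchange_big /= -(pair_big xpredT xpredT
      (fun a b => \sum_(p : L * L) F a b p.1 p.2)) /=.
    apply: eq_bigr => x _; apply: eq_bigr => y _.
    rewrite -(pair_big xpredT xpredT (F x y)) /=.
    by apply: eq_bigr => a _; rewrite /F -big_mkcond.
  (* With [xy] and [s] fixed, the hypothesis on [c] bounds the sum over all disjoint [ab]. *)
  have le2 x y : \sum_a \sum_(b | disjoint_pairs x y a b) C x y a b <=
      c * n / 4 * bond u f x y.
    under eq_bigr do rewrite exchange_big /=.
    rewrite exchange_big /= mulr_sumr; apply: ler_sum => s _.
    under eq_bigr do rewrite -!mulr_suml.
    rewrite -!mulr_suml [leRHS](_ : _ =
      c * n * (u s * u (exchange x y s)) / 4 * nabla x y f s ^+ 2); last by ring.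
    by rewrite ler_wpM2r ?sqr_ge0 // ler_wpM2r ?invr_ge0 // uc.
  have -> : c * n / 2 * B = 2 * (c * n / 4 * B) by field.
  rewrite ler_wpM2l // mulr_sumr; apply: ler_sum => x _.
  by rewrite mulr_sumr; apply: ler_sum => y _.
have := mulr_ge0 (_ : 0 <= 1 - r) B0; rewrite subr_ge0 => /(_ r1).
by move: disj shared diag; rewrite -/n; set X := sum3 _; lra.
Qed.

(** * Bounds on the Hamiltonian *)

(** The families [P = f^+ + g^-] and [Q = f^- + g^+] are nonnegative and summable with
    [P - Q = f - g]; the signed sum does not depend on which such decomposition is used. *)
Lemma usum_summableB (R : realType) (T : choiceType) (D : set T) (f g : T -> R) :
  summable D (EFin \o f) -> summable D (EFin \o g) ->
  usum D (fun i => f i - g i) = usum D f - usum D g.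
Proof.
move=> sf sg.
have pos (h : T -> R) : summable D (EFin \o h) -> summable D (EFin \o h^\+).
  by rewrite -funerpos; exact: summable_funepos.
have neg (h : T -> R) : summable D (EFin \o h) -> summable D (EFin \o h^\-).
  by rewrite -funerneg; exact: summable_funeneg.
have fin (h : T -> R) : (forall i, 0 <= h i) -> summable D (EFin \o h) ->
    (\esum_(i in D) (h i)%:E)%E \is a fin_num.
  move=> h0; rewrite summableE (_ : (\esum_(i in D) (h i)%:E)%E =
    (\esum_(i in D) `|(EFin \o h) i|)%E) //.
  by apply: eq_esum => i _ /=; rewrite ger0_norm.
pose P := ((EFin \o f^\+)%R \+ (EFin \o g^\-)%R)%E.
pose Q := ((EFin \o f^\-)%R \+ (EFin \o g^\+)%R)%E.
have sP : summable D P by apply: summableD; [exact: pos|exact: neg].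
have sQ : summable D Q by apply: summableD; [exact: neg|exact: pos].
have PQ : (P \- Q)%E = EFin \o (fun i => f i - g i).
  apply/funext => i; rewrite /P /Q /=.
  have /(congr1 (@^~ i)) := funrposBneg g; have /(congr1 (@^~ i)) := funrposBneg f.
  rewrite !fctE => <- <-; rewrite -?(EFinD, EFinN); congr EFin.
  by ring.
have := esumB sP sQ; rewrite PQ funerpos funerneg /usum => -> //; last 2 first.
- by move=> i _; rewrite /P /= -EFinD lee_fin addr_ge0.
- by move=> i _; rewrite /Q /= -EFinD lee_fin addr_ge0.
rewrite /P /Q !esumD //; try by move=> i _; rewrite /= lee_fin.
have fp := fin _ (@funrpos_ge0 _ _ f) (pos _ sf).
have fn := fin _ (@funrneg_ge0 _ _ f) (neg _ sf).
have gp := fin _ (@funrpos_ge0 _ _ g) (pos _ sg).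
have gn := fin _ (@funrneg_ge0 _ _ g) (neg _ sg).
rewrite !fineB ?fin_numD ?fp ?fn ?gp ?gn // !fineD //.
by rewrite /comp; ring.
Qed.

Lemma sum_abs_usum_le (R : realType) (T : choiceType) (D : set T) (J : finType)
    (P : pred J) (f : J -> T -> R) (g : T -> R) (k : R) :
  (forall i, D i -> \sum_(j | P j) `|f j i| <= g i) ->
  (\esum_(i in D) (g i)%:E <= k%:E)%E ->
  \sum_(j | P j) `|usum D (f j)| <= k.
Proof.
move=> fg gk; rewrite -lee_fin; apply: le_trans gk.
have sfg : (\sum_(j | P j) \esum_(i in D) `|f j i|%:E <= \esum_(i in D) (g i)%:E)%E.
  rewrite -esum_sum => [|i j _ _]; last by rewrite lee_fin.
  by apply: le_esum => i Di; rewrite sumEFin lee_fin fg.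
apply: le_trans sfg; rewrite -sumEFin; apply: lee_sum => j _.
rewrite /usum; set p := (\esum_(i in D) ((f j)^\+ i)%:E)%E.
set n := (\esum_(i in D) ((f j)^\- i)%:E)%E.
have p0 : (0 <= p)%E by apply: esum_ge0 => i _; rewrite lee_fin.
have n0 : (0 <= n)%E by apply: esum_ge0 => i _; rewrite lee_fin.
have -> : (\esum_(i in D) `|f j i|%:E = p + n)%E.
  rewrite /p /n -esumD; try by move=> i _; rewrite lee_fin.
  apply: eq_esum => i _; rewrite -EFinD; congr EFin.
  by have /(congr1 (@^~ i)) /= := funrposDneg (f j).
(* If [p] or [n] is infinite, [fine] returns the default 0 while [p + n] is [+oo]. *)
case: p n p0 n0 => [p| |] [n| |] //=; rewrite ?normr0 ?leey // !lee_fin.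
by move=> p0 n0; rewrite (le_trans (ler_normB _ _)) // !ger0_norm.
Qed.

Lemma abs_usum_le (R : realType) (T : choiceType) (D : set T)
    (f g : T -> R) (k : R) :
  (forall i, D i -> `|f i| <= g i) ->
  (\esum_(i in D) (g i)%:E <= k%:E)%E -> `|usum D f| <= k.
Proof.
move=> fg gk.
have := @sum_abs_usum_le _ _ D unit xpredT (fun=> f) g k.
rewrite big_const card_unit /= addr0; apply => // i Di.
by rewrite big_const card_unit /= addr0 fg.
Qed.

Lemma esum_combination_le (R : realType) (T : choiceType) (D : set T)
    (f g : T -> R) (c k : R) : 0 <= c ->
  (forall i, D i -> 0 <= f i) -> (forall i, D i -> 0 <= g i) ->
  (\esum_(i in D) (f i)%:E <= k%:E)%E -> (\esum_(i in D) (g i)%:E <= k%:E)%E ->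
  (\esum_(i in D) (c * (f i + g i))%:E <= (c * (2 * k))%:E)%E.
Proof.
move=> c0 f0 g0 fk gk.
have fgk : (\esum_(i in D) (f i + g i)%:E <= (2 * k)%:E)%E.
  rewrite (_ : 2 * k = k + k); last by ring.
  rewrite EFinD; apply: le_trans (leeD fk gk).
  by rewrite -esumD.
apply: ge_ereal_sup => _ [A [Afin AD] <-].
rewrite (_ : (\sum_(i \in A) _)%E = (c%:E * \sum_(i \in A) (f i + g i)%:E)%E).
  rewrite EFinM lee_wpmul2l //; apply: le_trans fgk.
  by apply: ereal_sup_ubound; exists A.
rewrite !fsbig_finite //= !sumEFin -EFinM mulr_sumr.
by [].
Qed.

(** This trades the extended-real norm for real data: [K] is its value and [m A] the supremum of
    [|Phi_A|]. That supremum is finite for nonempty [A] because [|A| >= 1] and a single term is at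
    most the sum through one of its sites. *)
Lemma pot_norm_bound (R : realType) (d : nat) (Phi : potential R d) :
  (pot_norm Phi < +oo)%E ->
  exists (K : R) (m : {fset Zd d} -> R),
    [/\ 0 <= K, forall A, 0 <= m A,
        forall A omega, A != fset0 -> `|pot_at Phi A omega| <= m A &
        forall (D : set {fset Zd d}) (x : Zd d),
          (\esum_(A in D) ((x \in A)%:R * (#|` A|%:R * m A))%:E <= K%:E)%E].
Proof.
move=> fin.
pose M A := ereal_sup (range (fun omega : config d => `|pot_at Phi A omega|%:E)).
have ubM A omega : (`|pot_at Phi A omega|%:E <= M A)%E.
  by apply: ereal_sup_ubound; exists omega.
have M0 A : (0 <= M A)%E.
  by apply: le_trans (ubM A (fun=> false)); rewrite lee_fin.
pose S x := (\esum_(A in [set A : {fset Zd d} | x \in A]) ((#|` A|%:R)%:E * M A))%E.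
have term0 A : (0 <= (#|` A|%:R)%:E * M A)%E by rewrite mule_ge0.
have SK x : (S x <= pot_norm Phi)%E by apply: ereal_sup_ubound; exists x.
have norm0 : (0 <= pot_norm Phi)%E.
  by apply: le_trans (SK 0); apply: esum_ge0.
have normK : ((fine (pot_norm Phi))%:E = pot_norm Phi)%E.
  by rewrite fineK // ge0_fin_numE.
have Mfin A : A != fset0 -> ((fine (M A))%:E = M A)%E.
  case/fset0Pn => x xA; rewrite fineK // ge0_fin_numE //.
  apply: le_lt_trans fin; apply: le_trans (SK x).
  have card1 : 1 <= #|` A|%:R :> R.
    by rewrite ler1n cardfs_gt0; apply/fset0Pn; exists x.
  apply: (@le_trans _ _ ((#|` A|%:R)%:E * M A)%E).
    by rewrite -[leLHS]mul1e lee_wpmul2r // lee_fin.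
  rewrite /S (esumID [set A]%classic) //.
  rewrite (_ : ([set B : {fset Zd d} | x \in B] `&` [set A])%classic = [set A]%classic).
    by rewrite esum_set1 // leeDl // esum_ge0.
  by apply/seteqP; split => [B [] //|B /= ->].
exists (fine (pot_norm Phi)), (fun A => fine (M A)); split => //.
- exact: fine_ge0.
- by move=> A; exact: fine_ge0.
- by move=> A omega A0; rewrite -lee_fin Mfin.
move=> D x; rewrite normK; apply: le_trans (SK x).
rewrite /S esum_mkcond [leRHS]esum_mkcond; apply: le_esum => A _.
have -> : (A \in [set B : {fset Zd d} | x \in B]%classic) = (x \in A).
  by apply/idP/idP; rewrite inE.
have [xA|_] := boolP (x \in A); last by rewrite mul0r if_same.
rewrite mul1r; case: ifP => _; last exact: term0.
by rewrite EFinM Mfin //; apply/fset0Pn; exists x.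
Qed.

Lemma glue_in (d : nat) (L : {fset Zd d}) (tau : boundary L)
    (eta : {ffun L -> bool}) (x : L) : Defs.glue tau eta (val x) = eta x.
Proof.
(* Abstracting the boolean index of [alt_spec] makes case analysis on the dependent match
   possible. *)
suff gen b (p : alt_spec (val x \in L) (val x \in L) b) :
  match p with
  | AltTrue xL => eta [` xL]
  | AltFalse xNL => tau (exist _ (val x) xNL)
  end = eta x by exact: gen.
case: p => [xL|xL]; last by exfalso; exact: (negP xL (valP x)).
by congr (eta _); exact: val_inj.
Qed.

Lemma glue_out (d : nat) (L : {fset Zd d}) (tau : boundary L)
    (eta zeta : {ffun L -> bool}) (w : Zd d) : w \notin L ->
  Defs.glue tau eta w = Defs.glue tau zeta w.
Proof.
move=> wL.
suff gen b (p : alt_spec (w \in L) (w \in L) b) :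
  match p with
  | AltTrue xL => eta [` xL]
  | AltFalse xNL => tau (exist _ w xNL)
  end = match p with
  | AltTrue xL => zeta [` xL]
  | AltFalse xNL => tau (exist _ w xNL)
  end by exact: gen.
by case: p => // wL'; exfalso; exact: (negP wL wL').
Qed.

Lemma glue_exchange (d : nat) (L : {fset Zd d}) (tau : boundary L) (N : nat)
    (s : SN L N) (x y : L) (w : Zd d) : w != val x -> w != val y ->
  Defs.glue tau (val (exchange x y s)) w = Defs.glue tau (val s) w.
Proof.
move=> wx wy; have [wL|wL] := boolP (w \in L).
  have -> : w = val [` wL] by [].
  rewrite !glue_in exchangeE tpermD //.
  - by apply: contraNneq wx => ->.
  - by apply: contraNneq wy => ->.
exact: glue_out.
Qed.

Lemma pot_at_exchange (R : realType) (d : nat) (Phi : potential R d)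
    (L : {fset Zd d}) (tau : boundary L) (N : nat) (s : SN L N) (x y : L)
    (A : {fset Zd d}) : val x \notin A -> val y \notin A ->
  pot_at Phi A (Defs.glue tau (val (exchange x y s))) =
  pot_at Phi A (Defs.glue tau (val s)).
Proof.
move=> xA yA; rewrite /pot_at; congr (Phi A _); apply/ffunP => w.
rewrite !ffunE glue_exchange //.
- by apply: contraNneq xA => <-; exact: valP.
- by apply: contraNneq yA => <-; exact: valP.
Qed.

Lemma sum_mem_le (R : realType) (d : nat) (L A : {fset Zd d}) :
  \sum_(a : L) (val a \in A)%:R <= #|` A|%:R :> R.
Proof.
rewrite -natr_sum ler_nat -big_mkcond sum1_card cardE.
rewrite -(size_map val); apply: uniq_leq_size.
  by rewrite map_inj_uniq ?enum_uniq //; exact: val_inj.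
by move=> w /mapP[a]; rewrite mem_enum => aA ->.
Qed.

(** A set meeting [L] contains some site of [L], so the sum is at most the finite sum over [x] in
    [L] of the sums through [x]. *)
Lemma summable_pot_at (R : realType) (d : nat) (Phi : potential R d) (K : R)
    (m : {fset Zd d} -> R) (L : {fset Zd d}) (omega : config d) :
  (forall A, 0 <= m A) ->
  (forall A omega, A != fset0 -> `|pot_at Phi A omega| <= m A) ->
  (forall (D : set {fset Zd d}) (x : Zd d),
     (\esum_(A in D) ((x \in A)%:R * (#|` A|%:R * m A))%:E <= K%:E)%E) ->
  summable [set A : {fset Zd d} | (A `&` L)%fset != fset0]%classic
    (EFin \o (fun A => pot_at Phi A omega)).
Proof.
move=> m0 mPhi mK; rewrite /summable.
set D := [set A | _]%classic.
have sumK : (\sum_(x : L)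
    \esum_(A in D) ((val x \in A)%:R * (#|` A|%:R * m A))%:E <
    +oo)%E.
  apply: (@le_lt_trans _ _ (\sum_(x : L) K%:E)%E).
    by apply: lee_sum => x _; exact: mK.
  by rewrite sumEFin ltry.
apply: le_lt_trans sumK; rewrite -esum_sum => [|A x _ _]; last first.
  by rewrite lee_fin !mulr_ge0.
apply: le_esum => A /fset0Pn[x]; rewrite in_fsetI => /andP[xA xL].
have A0 : A != fset0 by apply/fset0Pn; exists x.
rewrite /= sumEFin lee_fin (bigD1 [` xL]) //= xA mul1r.
rewrite -[leLHS]addr0; apply: lerD; last first.
  by apply: sumr_ge0 => z _; rewrite !mulr_ge0.
apply: le_trans (mPhi A omega A0) _.
by rewrite -[leLHS]mul1r ler_wpM2r // ler1n cardfs_gt0.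
Qed.

Lemma pot_at_nabla_le (R : realType) (d : nat) (Phi : potential R d)
    (m : {fset Zd d} -> R) (L : {fset Zd d}) (tau : boundary L) (N : nat)
    (A : {fset Zd d}) (x y : L) (s : SN L N) :
  (forall A, 0 <= m A) ->
  (forall A omega, A != fset0 -> `|pot_at Phi A omega| <= m A) ->
  `|pot_at Phi A (Defs.glue tau (val (exchange x y s))) -
    pot_at Phi A (Defs.glue tau (val s))| <=
  2 * m A * ((val x \in A)%:R + (val y \in A)%:R).
Proof.
move=> m0 mPhi.
have [/andP[xA yA]|xyA] := boolP ((val x \notin A) && (val y \notin A)).
  by rewrite pot_at_exchange // subrr normr0 mulr_ge0 ?mulr_ge0 // addr_ge0.
have A0 : A != fset0.
  apply/fset0Pn; move: xyA; rewrite negb_and !negbK => /orP[] h;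
    by [exists (val x) | exists (val y)].
have ind : 1 <= (val x \in A)%:R + (val y \in A)%:R :> R.
  move: xyA; rewrite negb_and !negbK => /orP[] ->.
    by rewrite lerDl.
  by rewrite lerDr.
apply: (@le_trans _ _ (2 * m A)); last by rewrite ler_peMr // mulr_ge0.
rewrite (le_trans (ler_normB _ _)) // mulr_natl mulr2n.
by rewrite lerD // mPhi.
Qed.

(** Only sets containing [x] or [y] contribute, each at most [2 m A] per such site, and [|A| >= 1]
    bounds the sum through a site by [K]. *)
Lemma nabla_HN_le (R : realType) (d : nat) (Phi : potential R d) (K : R)
    (m : {fset Zd d} -> R) (L : {fset Zd d}) (tau : boundary L) (N : nat)
    (x y : L) (s : SN L N) :
  (forall A, 0 <= m A) ->
  (forall A omega, A != fset0 -> `|pot_at Phi A omega| <= m A) ->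
  (forall (D : set {fset Zd d}) (x : Zd d),
     (\esum_(A in D) ((x \in A)%:R * (#|` A|%:R * m A))%:E <= K%:E)%E) ->
  `|nabla x y (HN Phi tau (N := N)) s| <= 4 * K.
Proof.
move=> m0 mPhi mK; rewrite /nabla /HN /hamiltonian -usum_summableB;
  try exact: summable_pot_at m0 mPhi mK.
rewrite (_ : 4 * K = 2 * (2 * K)); last by ring.
apply: abs_usum_le (esum_combination_le _ _ _ (mK _ (val x)) (mK _ (val y)));
  rewrite ?mulr_ge0 // => A; try by rewrite !mulr_ge0.
move=> /fset0Pn[z]; rewrite in_fsetI => /andP[zA _].
apply: le_trans (pot_at_nabla_le tau A x y s m0 mPhi) _.
rewrite -mulrDl -mulrA ler_wpM2l // mulrC ler_wpM2l //.
rewrite -[leLHS]mul1r ler_wpM2r // ler1n cardfs_gt0.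
by apply/fset0Pn; exists z.
Qed.

(** Since the exchanges commute, [A] contributes only if it meets both [{x, y}] and [{a, b}].
    Summing the indicators over [a] and [b] yields at most [2 n |A|], which is where the weight
    [|A|] in the norm enters; the sum over [A] then gives [8 n * 2 K]. *)
Lemma nabla2_HN_le (R : realType) (d : nat) (Phi : potential R d) (K : R)
    (m : {fset Zd d} -> R) (L : {fset Zd d}) (tau : boundary L) (N : nat)
    (x y : L) (s : SN L N) :
  (forall A, 0 <= m A) ->
  (forall A omega, A != fset0 -> `|pot_at Phi A omega| <= m A) ->
  (forall (D : set {fset Zd d}) (x : Zd d),
     (\esum_(A in D) ((x \in A)%:R * (#|` A|%:R * m A))%:E <= K%:E)%E) ->
  \sum_a \sum_(b | disjoint_pairs x y a b)
    `|nabla x y (HN Phi tau (N := N)) (exchange a b s) -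
      nabla x y (HN Phi tau (N := N)) s| <= 16 * #|{: L}|%:R * K.
Proof.
move=> m0 mPhi mK; rewrite pair_big_dep /=.
pose phi s A := pot_at Phi A (Defs.glue tau (val (s : SN L N))).
pose t (p : L * L) A := (phi (exchange x y (exchange p.1 p.2 s)) A -
  phi (exchange p.1 p.2 s) A) - (phi (exchange x y s) A - phi s A).
pose D := [set A : {fset Zd d} | (A `&` L)%fset != fset0]%classic.
have phis s' : summable D (EFin \o phi s') by exact: summable_pot_at m0 mPhi mK.
have tE p : usum D (t p) =
    nabla x y (HN Phi tau (N := N)) (exchange p.1 p.2 s) -
    nabla x y (HN Phi tau (N := N)) s.
  have dphis s1 s2 : summable D (EFin \o (fun A => phi s1 A - phi s2 A)).
    exact: (summableB (phis s1) (phis s2)).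
  by rewrite /t (usum_summableB (dphis _ _) (dphis _ _)) !usum_summableB.
under eq_bigr do rewrite -tE.
rewrite (_ : 16 * _ * K = (8 * #|{: L}|%:R) * (2 * K)); last by ring.
apply: sum_abs_usum_le (esum_combination_le _ _ _ (mK _ (val x)) (mK _ (val y)));
  rewrite ?mulr_ge0 // => A; try by rewrite !mulr_ge0.
move=> _.
set I : R := (val x \in A)%:R + (val y \in A)%:R.
have I0 : 0 <= I by rewrite addr_ge0.
pose J (a : L) : R := (val a \in A)%:R.
have tle p : disjoint_pairs x y p.1 p.2 -> `|t p A| <= 4 * m A * I * (J p.1 + J p.2).
  case: p => a b /= dis; rewrite /J.
  have [/andP[aA bA]|abA] := boolP ((val a \notin A) && (val b \notin A)).
    rewrite /t /fst /snd exchange_comm // /phi !(pot_at_exchange _ _ _ aA bA).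
    by rewrite subrr normr0 mulr_ge0 ?mulr_ge0 // addr_ge0.
  have ind : 1 <= (val a \in A)%:R + (val b \in A)%:R :> R.
    move: abA; rewrite negb_and !negbK => /orP[] ->.
      by rewrite lerDl.
    by rewrite lerDr.
  apply: (@le_trans _ _ (4 * m A * I)); last first.
    by rewrite ler_peMr // mulr_ge0 ?mulr_ge0.
  rewrite (le_trans (ler_normB _ _)) //.
  rewrite (_ : 4 * m A * I = 2 * m A * I + 2 * m A * I); last by ring.
  by rewrite lerD // pot_at_nabla_le.
apply: (@le_trans _ _ (\sum_(p : L * L) 4 * m A * I * (J p.1 + J p.2))).
  rewrite [leLHS]big_mkcond; apply: ler_sum => p _.
  case: ifP => [/tle //|_]; rewrite mulr_ge0 ?mulr_ge0 // addr_ge0 //.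
rewrite -mulr_sumr -(pair_big xpredT xpredT (fun a b => J a + J b)) /=.
have -> : \sum_a \sum_b (J a + J b) = 2 * #|{: L}|%:R * \sum_a J a.
  under eq_bigr do rewrite big_split /= sumr_const.
  rewrite big_split /= sumr_const sumrMnl -[_ *+ _]mulr_natl; ring.
rewrite -mulrDl -/I [leRHS](_ : _ =
  4 * m A * I * (2 * #|{: L}|%:R * #|` A|%:R)); last by ring.
rewrite ler_wpM2l ?mulr_ge0 // ler_wpM2l ?mulr_ge0 //.
exact: sum_mem_le.
Qed.

(** * The Kawasaki generator *)

Lemma expR_sub_le (R : realType) (a b M : R) :
  expR a <= M -> expR b <= M -> `|expR a - expR b| <= M * `|a - b|.
Proof.
wlog ab : a b / b <= a => [gen aM bM|aM _].
  have [/gen|/ltW/gen] := leP b a; first exact.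
  by rewrite distrC (distrC b); exact.
rewrite !ger0_norm ?subr_ge0 ?ler_expR //.
rewrite (_ : expR a - expR b = expR a * (1 - expR (b - a))); last first.
  by rewrite mulrBr mulr1 -expRD; congr (_ - expR _); ring.
have h : 1 - expR (b - a) <= a - b by have := expR_ge1Dx (b - a); lra.
apply: (le_trans (ler_wpM2l (expR_ge0 a) h)).
by rewrite ler_wpM2r // subr_ge0.
Qed.

(** Both configurations have [N] particles, so an inequality between them at every site must be an
    equality. *)
Lemma SN_eq_of_le (d : nat) (L : {fset Zd d}) (N : nat) (s t : SN L N) :
  (forall x, val s x -> val t x) -> s = t.
Proof.
move=> st; apply/val_inj/ffunP => x.
have leif y (_ : true) :
    (nat_of_bool (val s y) <= val t y ?= iff (val s y == val t y))%N.
  by move: (st y); case: (val s y); case: (val t y) => // /(_ isT).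
have [_] := leqif_sum leif.
by rewrite (eqP (valP s)) (eqP (valP t)) eqxx => /esym/forallP/(_ x)/eqP.
Qed.

(** Irreducibility: as long as [s] differs from [t], there is a site occupied only in [s] and one
    occupied only in [t], and exchanging them shrinks the set of disagreements. *)
Lemma exchange_invariant_const (T : Type) (d : nat) (L : {fset Zd d}) (N : nat)
    (f : SN L N -> T) :
  (forall x z s, f (exchange x z s) = f s) -> forall s t, f s = f t.
Proof.
move=> finv s t.
have [k] := ubnP #|[pred x | val s x != val t x]|; elim: k s => // k IH s.
have [[x /andP[sx tx]]|nx] := pselect (exists x, val s x && ~~ val t x); last first.
  rewrite (@SN_eq_of_le _ _ _ s t) // => x sx.
  by apply: contrapT => tx; apply: nx; exists x; rewrite sx; exact/negP.
have [[z /andP[tz sz]]|nz] := pselect (exists z, val t z && ~~ val s z); last first.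
  rewrite (@SN_eq_of_le _ _ _ t s) // => z tz.
  by apply: contrapT => sz; apply: nz; exists z; rewrite tz; exact/negP.
rewrite ltnS => lek; rewrite -(finv x z s); apply: IH.
apply: leq_trans (proper_card _) lek; apply/properP; split.
  apply/fintype.subsetP => w; rewrite !inE exchangeE.
  have [->|wx] := eqVneq w x; first by rewrite sx (negPf tx).
  have [->|wz] := eqVneq w z; first by rewrite tz (negPf sz).
  by rewrite tpermD // eq_sym.
exists x; first by rewrite inE sx (negPf tx).
by rewrite inE exchangeE tpermL (negPf sz) (negPf tx).
Qed.

Lemma sum_ordered_pairs (R : realType) (T : finType) (g : T -> T -> R) :
  (forall x z, g z x = g x z) -> (forall x, g x x = 0) ->
  \sum_x \sum_(z | (enum_rank x < enum_rank z)%N) g x z =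
  2^-1 * \sum_x \sum_z g x z.
Proof.
move=> gC g0; set S := LHS.
suff -> : \sum_x \sum_z g x z = S + S by field.
have E x : \sum_z g x z = \sum_(z | (enum_rank x < enum_rank z)%N) g x z +
    \sum_(z | (enum_rank z < enum_rank x)%N) g x z.
  rewrite [X in _ = X + _]big_mkcond [X in _ = _ + X]big_mkcond -big_split.
  apply: eq_bigr => z _ /=; case: ltngtP => [_|_|e]; rewrite ?addr0 ?add0r //.
  by move/val_inj/enum_rank_inj: e => ->.
under eq_bigr do rewrite E.
rewrite big_split /=; congr (_ + _).
rewrite (exchange_big_dep predT) //=; apply: eq_bigr => x _.
by apply: eq_bigr => z _; rewrite gC.
Qed.

(** The square root of the Gibbs weight: [nu] is proportional to its square, and the jump rate from
    [s] to [s^xz] is [u (s^xz) / u s], up to [1 / |L|]. *)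
Definition sqrt_weight (R : realType) (d : nat) (Phi : potential R d) (beta : R)
    (L : {fset Zd d}) (tau : boundary L) (N : nat) (s : SN L N) : R :=
  expR (- (2^-1 * beta * HN Phi tau s)).

Lemma generatorE (R : realType) (d : nat) (Phi : potential R d) (beta : R)
    (L : {fset Zd d}) (tau : boundary L) (N : nat) (f : SN L N -> R)
    (s : SN L N) (u := sqrt_weight Phi beta tau (N := N)) :
  generator Phi beta tau f s = (2 * #|` L|%:R)^-1 * (u s)^-1 *
    \sum_x \sum_z u (exchange x z s) * nabla x z f s.
Proof.
pose g x z := #|` L|%:R^-1 * (u s)^-1 * (u (exchange x z s) * nabla x z f s).
transitivity (\sum_(x : L) \sum_(z : L | (enum_rank x < enum_rank z)%N) g x z).
  apply: eq_bigr => x _; apply: eq_bigr => z _; rewrite /g -!mulrA.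
  congr (_ * _); rewrite [RHS]mulrA; congr (_ * _).
  rewrite /u /sqrt_weight -expRN -expRD; congr expR.
  by rewrite /nabla; ring.
rewrite sum_ordered_pairs => [|x z|x]; last 2 first.
- by rewrite /g /nabla (exchangeC z x).
- by rewrite /g nabla_eq0 // !mulr0.
rewrite invfM; under eq_bigr do rewrite -mulr_sumr.
by rewrite -mulr_sumr !mulrA.
Qed.

Lemma nuNE (R : realType) (d : nat) (Phi : potential R d) (beta : R)
    (L : {fset Zd d}) (tau : boundary L) (N : nat) (s : SN L N)
    (u := sqrt_weight Phi beta tau (N := N)) :
  nuN Phi beta tau s = u s ^+ 2 / \sum_t u t ^+ 2.
Proof.
have uE t : u t ^+ 2 = expR (- (beta * HN Phi tau t)).
  by rewrite /u /sqrt_weight expr2 -expRD; congr expR; field.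
by rewrite /nuN -uE; congr (_ / _); apply: eq_bigr.
Qed.

(** Reversibility: [u s * u (s^xz)] is invariant under the exchange, so each term may be averaged
    with its image. *)
Lemma dirichlet_form (R : realType) (d : nat) (L : {fset Zd d}) (N : nat)
    (u f g : SN L N -> R) :
  \sum_s u s * f s * (\sum_x \sum_z u (exchange x z s) * nabla x z g s) =
  - 2^-1 * \sum_x \sum_z \sum_s
     u s * u (exchange x z s) * nabla x z f s * nabla x z g s.
Proof.
under eq_bigr do rewrite mulr_sumr.
rewrite exchange_big mulr_sumr /=; apply: eq_bigr => x _.
under eq_bigr do rewrite mulr_sumr.
rewrite exchange_big mulr_sumr /=; apply: eq_bigr => z _.
set F := fun s => u s * f s * (u (exchange x z s) * nabla x z g s).
have : \sum_s F s = \sum_s F (exchange x z s).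
  by rewrite (sum_involution F (exchangeK x z)).
move=> e; have -> : \sum_s F s = 2^-1 * (\sum_s (F s + F (exchange x z s))).
  by rewrite big_split /= -e; field.
rewrite !mulr_sumr; apply: eq_bigr => s _.
by rewrite /F /nabla exchangeK; ring.
Qed.

(** The Bochner inequality is applied with [r = 1 - 2 beta K], from the first differences of [H],
    and [c = 16 beta K], from the second differences. *)
Lemma generator_bochner (R : realType) (d : nat) (Phi : potential R d) (K : R)
    (m : {fset Zd d} -> R) (L : {fset Zd d}) (tau : boundary L) (N : nat)
    (beta : R) (f : SN L N -> R) (u := sqrt_weight Phi beta tau (N := N)) :
  0 <= K -> (forall A, 0 <= m A) ->
  (forall A omega, A != fset0 -> `|pot_at Phi A omega| <= m A) ->
  (forall (D : set {fset Zd d}) (x : Zd d),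
     (\esum_(A in D) ((x \in A)%:R * (#|` A|%:R * m A))%:E <= K%:E)%E) ->
  0 <= beta -> beta * K <= 4^-1 ->
  (1 - 12 * (beta * K)) * #|{: L}|%:R * (\sum_x \sum_y bond u f x y) <=
  \sum_s (\sum_x \sum_y u (exchange x y s) * nabla x y f s) ^+ 2.
Proof.
move=> K0 m0 mPhi mK b0 bK; pose h := HN Phi tau (N := N).
have hb : 0 <= 2^-1 * beta by rewrite mulr_ge0 ?invr_ge0.
have hh x y s : `|nabla x y h s| <= 4 * K by exact: nabla_HN_le m0 mPhi mK.
have bh x y s : `|2^-1 * beta * nabla x y h s| <= 2 * (beta * K).
  rewrite normrM (ger0_norm hb).
  have := ler_wpM2l b0 (hh x y s); lra.
have uex x y s : u (exchange x y s) = u s * expR (- (2^-1 * beta * nabla x y h s)).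
  by rewrite /u /sqrt_weight -expRD; congr expR; rewrite /nabla /h; ring.
have u0 s : 0 < u s by exact: expR_gt0.
(* The exponent is at most [2 beta K <= 1/2] in absolute value, and [exp t >= 1 + t >= 1/2]. *)
have e2 x y s : expR (- (2^-1 * beta * nabla x y h s)) <= 2.
  rewrite expRN -[leRHS]invrK lef_pV2 ?posrE ?expR_gt0 ?invr_gt0 //.
  apply: le_trans (expR_ge1Dx _).
  by have := bh x y s; rewrite ler_norml => /andP[]; lra.
have -> : 1 - 12 * (beta * K) =
    2 * (1 - 2 * (beta * K)) - 1 - (16 * (beta * K)) / 2 by field.
apply: bochner => // [|x y s|x y s].
- by have := mulr_ge0 b0 K0; lra.
- rewrite uex mulrC ler_wpM2l ?(ltW (u0 s)) //.
  apply: le_trans (expR_ge1Dx _).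
  by have := bh x y s; rewrite ler_norml => /andP[]; lra.
have u2 : 0 <= u s * u (exchange x y s) by rewrite mulr_ge0 // ltW.
apply: (@le_trans _ _ (\sum_a \sum_(b | disjoint_pairs x y a b)
    beta * (u s * u (exchange x y s)) *
    `|nabla x y h (exchange a b s) - nabla x y h s|)).
  apply: ler_sum => a _; apply: ler_sum => b dis.
  (* Factoring out [u s * u (s^xy)] leaves a difference of two exponentials whose exponents differ
     by [beta / 2] times a second difference of [H]; the bound 2 on the exponentials cancels the
     half. *)
  have -> : u (exchange x y s) * u (exchange a b s) -
            u s * u (exchange x y (exchange a b s)) =
     (u s * u (exchange x y s)) *
     (expR (- (2^-1 * beta * nabla a b h s)) -
      expR (- (2^-1 * beta * nabla a b h (exchange x y s)))).
    by rewrite exchange_comm // (uex a b s) (uex a b (exchange x y s)); ring.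
  rewrite normrM ger0_norm // (mulrC beta) -[leRHS]mulrA ler_wpM2l //.
  apply: (le_trans (expR_sub_le (e2 _ _ _) (e2 _ _ _))).
  have -> : - (2^-1 * beta * nabla a b h s) - - (2^-1 * beta * nabla a b h (exchange x y s)) =
    2^-1 * beta * (nabla x y h (exchange a b s) - nabla x y h s).
    by rewrite /nabla (exchange_comm s dis); ring.
  rewrite normrM (ger0_norm hb).
  by rewrite !mulrA divff // mul1r.
under eq_bigr do rewrite -mulr_sumr.
rewrite -mulr_sumr.
have := nabla2_HN_le tau x y s m0 mPhi mK.
have bu : 0 <= beta * (u s * u (exchange x y s)) by rewrite mulr_ge0.
move=> /(ler_wpM2l bu) /le_trans; apply.
by rewrite le_eqVlt; apply/orP; left; apply/eqP; ring.
Qed.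

Theorem theorem3p1 (R : realType) (d : nat) (Phi : potential R d)
    (hPhi : (pot_norm Phi < +oo)%E)
    (lambda : R) (hlambda0 : 0 < lambda) (hlambda1 : lambda < 1) :
  exists beta_lambda : R, 0 < beta_lambda /\
    forall (L : {fset Zd d}) (tau : boundary L) (N : nat) (beta : R),
      (N <= #|` L|)%N -> 0 < beta -> beta <= beta_lambda ->
      (lambda%:E <=
        gap (nuN Phi beta tau (N:=N)) (generator Phi beta tau (N:=N)))%E.
Proof.
have [K [m [K0 m0 mPhi mK]]] := pot_norm_bound hPhi.
have K12 : 0 < 12 * (K + 1) by rewrite mulr_gt0 // ltr_wpDl.
(* Chosen so that [1 - 12 beta K >= lambda]; [K + 1] keeps the denominator positive when [K = 0]. *)
exists ((1 - lambda) / (12 * (K + 1))); split.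
  by rewrite divr_gt0 // subr_gt0.
move=> L tau N beta _ beta0; rewrite ler_pdivlMr // => betaK.
have bK : 12 * (beta * K) <= 1 - lambda by lra.
apply: ereal_sup_ubound; exists lambda => //; split; first exact: ltW.
have [s0 _|S0] := pickP (predT : pred (SN L N)); last first.
  by move=> f; rewrite /expect !big_pred0 // expr0n /= !subr0 mulr0 oppr0.
pose u := sqrt_weight Phi beta tau (N := N); pose n : R := #|` L|%:R.
pose A f s : R := \sum_x \sum_z u (exchange x z s) * nabla x z f s.
have u0 s : 0 < u s by exact: expR_gt0.
pose Z := \sum_s u s ^+ 2.
have Z0 : 0 < Z.
  rewrite /Z (bigD1 s0) //= ltr_pwDl ?exprn_gt0 // sumr_ge0 // => s _.
  exact: sqr_ge0.
pose B f g := \sum_x \sum_z \sum_s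
  u s * u (exchange x z s) * nabla x z f s * nabla x z g s.
have quarter : 4^-1 = 2^-1 * 2^-1 :> R by field.
(* The weight [u^2 / Z] absorbs the [1 / u] of the generator; half of the factor [1/4] comes from
   ordered pairs, half from the integration by parts. *)
have EfG f g : expect (nuN Phi beta tau (N := N))
    (fun s => f s * generator Phi beta tau g s) = - ((4 * n * Z)^-1 * B f g).
  transitivity ((2 * n * Z)^-1 * \sum_s u s * f s * A g s).
    rewrite /expect mulr_sumr; apply: eq_bigr => s _; rewrite nuNE generatorE.
    rewrite -/u -/n -/Z -/(A g s) !invfM.
    have -> : u s ^+ 2 / Z * (f s * (2^-1 * n^-1 * (u s)^-1 * A g s)) =
      (u s / u s) * (2^-1 * n^-1 * Z^-1 * (u s * f s * A g s)) by ring.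
    by rewrite divff ?mul1r // gt_eqF.
  by rewrite dirichlet_form -/(B f g) !invfM quarter; ring.
have EGG g : expect (nuN Phi beta tau (N := N))
    (fun s => generator Phi beta tau g s ^+ 2) =
    (4 * n ^+ 2 * Z)^-1 * \sum_s A g s ^+ 2.
  rewrite /expect mulr_sumr; apply: eq_bigr => s _; rewrite nuNE generatorE.
  rewrite -/u -/n -/Z -/(A g s) !invfM.
  have -> : u s ^+ 2 / Z * (2^-1 * n^-1 * (u s)^-1 * A g s) ^+ 2 =
    (u s / u s) ^+ 2 * (4^-1 * (n^-1 / n) / Z * A g s ^+ 2).
    by rewrite quarter; ring.
  by rewrite divff ?expr1n ?mul1r // gt_eqF.
have BE f : B f f = \sum_x \sum_z bond u f x z.
  apply: eq_bigr => x _; apply: eq_bigr => z _; apply: eq_bigr => s _.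
  by rewrite expr2 !mulrA.
have term0 f x z s : 0 <= u s * u (exchange x z s) * nabla x z f s ^+ 2.
  by rewrite mulr_ge0 ?sqr_ge0 // mulr_ge0 // ltW.
have bond0 f x z : 0 <= bond u f x z by apply: sumr_ge0.
have B0 f : 0 <= B f f by rewrite BE !sumr_ge0 // => x _; exact: sumr_ge0.
have n0 : 0 <= n by [].
apply: poincare_of_bochner; first exact: ltW.
- under eq_bigr do rewrite nuNE.
  by rewrite -mulr_suml divff // gt_eqF.
- move=> a f g s; rewrite !generatorE -/u mulrCA -mulrDr; congr (_ * _).
  rewrite mulr_sumr -big_split; apply: eq_bigr => x _ /=.
  rewrite mulr_sumr -big_split; apply: eq_bigr => z _ /=.
  by rewrite /nabla; ring.
- move=> c s; rewrite generatorE big1 ?mulr0 // => x _.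
  by rewrite big1 // => z _; rewrite /nabla subrr mulr0.
- move=> f g; rewrite !EfG; congr (- (_ * _)).
  apply: eq_bigr => x _; apply: eq_bigr => z _; apply: eq_bigr => s _.
  by rewrite mulrAC.
- move=> f; rewrite EfG oppr_le0 mulr_ge0 // invr_ge0 mulr_ge0 ?(ltW Z0) //.
  by rewrite mulr_ge0.
(* A vanishing Dirichlet form is a sum of nonnegative terms with positive weights, so every gradient
   is zero. *)
- move=> f Ef; apply: exchange_invariant_const => x z s.
  have n_neq0 : n != 0.
    by rewrite pnatr_eq0 -lt0n cardfs_gt0; apply/fset0Pn; exists (val x); exact: valP.
  move: Ef; rewrite EfG => /eqP; rewrite oppr_eq0 mulf_eq0 invr_eq0.
  rewrite !mulf_eq0 pnatr_eq0 (negPf n_neq0) (gt_eqF Z0) /= BE.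
  rewrite psumr_eq0 => [|y _]; last exact: sumr_ge0.
  move=> /allP/(_ x (mem_index_enum _)) /=.
  rewrite psumr_eq0 // => /allP/(_ z (mem_index_enum _)) /=.
  rewrite psumr_eq0 // => /allP/(_ s (mem_index_enum _)) /=.
  by rewrite !mulf_eq0 !(gt_eqF (u0 _)) /= orbb subr_eq0 => /eqP.
move=> f; rewrite EfG EGG opprK.
(* For empty [L] the inverse of 0 is 0 and both sides vanish. *)
have [n_eq0|n_neq0] := eqVneq n 0.
  by rewrite n_eq0 expr0n /= !(mulr0, mul0r) invr0 !mul0r mulr0.
have -> : lambda * ((4 * n * Z)^-1 * B f f) =
    (4 * n ^+ 2 * Z)^-1 * (lambda * n * B f f).
  by field; rewrite n_neq0 gt_eqF.
rewrite ler_wpM2l //.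
  by rewrite invr_ge0 mulr_ge0 ?(ltW Z0) // mulr_ge0 // sqr_ge0.
have bK4 : beta * K <= 4^-1 by lra.
have := generator_bochner tau f K0 m0 mPhi mK (ltW beta0) bK4.
rewrite -/u -BE -cardfE -/n; apply: le_trans.
rewrite ler_wpM2r // ler_wpM2r //; lra.
Qed.
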